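(* Let $s\ge 1$ and $r_1,\dots,r_s\ge 1$ be integers such that for every $i<s$ at least one of $r_i$ and $r_{i+1}$ is equal to $1$. Then for all sufficiently large $n$ there exists a $P_{s+1}$-free family $\mathcal{F}_n\subseteq 2^{[n]}$ that is a union of full levels of $2^{[n]}$ such that $$La(n,P_{s+1},K_{r_1,r_2,\dots,r_s})=c(K_{r_1,r_2,\dots,r_s},\mathcal{F}_n).$$
   Context: $[n]=\{1,\dots,n\}$, $2^{[n]}$ is the family of all subsets of $[n]$; the full levels of $2^{[n]}$ are the families $\binom{[n]}{k}$ of all $k$-element subsets of $[n]$. For a finite poset $P$ and a family $\mathcal{F}$ of sets, a subfamily $\mathcal{G}\subseteq\mathcal{F}$ is a copy of $P$ in $\mathcal{F}$ if there is a bijection $\phi:P\to\mathcal{G}$ such that $x\le_Px'$ implies $\phi(x)\subseteq\phi(x')$ (the converse is not required). $c(P,\mathcal{F})$ is the number of copies of $P$ in $\mathcal{F}$; $\mathcal{F}$ is $P$-free if $c(P,\mathcal{F})=0$. $La(n,P,Q)=\max\{c(Q,\mathcal{F}):\mathcal{F}\subseteq 2^{[n]},\ c(P,\mathcal{F})=0\}$. $P_k$ is the chain on $k$ elements. The complete multi-level poset $K_{r_1,\dots,r_s}$ has $\sum_{i=1}^sr_i$ elements $a^i_h$ ($1\le i\le s$, $1\le h\le r_i$) with $a^i_h<a^j_l$ if and only if $i<j$. *)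

(* Defs.v *)
From HB Require Import structures.
From mathcomp Require Import all_boot all_order.

Set Implicit Arguments.
Unset Strict Implicit.
Unset Printing Implicit Defensive.

Import Order.TTheory.

(* A copy of P is the image family G itself, not the map phi; as in the      *)
(* literature on (weak) forbidden subposets, phi need not reflect the order. *)
Definition is_copy (n : nat) (d : Order.disp_t) (P : finPOrderType d)
    (G : {set {set 'I_n}}) : bool :=
  [exists phi : {ffun P -> {set 'I_n}},
    [&& injectiveb phi, [set phi x | x : P] == G
      & [forall x, forall y, (x <= y)%O ==> (phi x \subset phi y)]]].

Definition copies (n : nat) (d : Order.disp_t) (P : finPOrderType d)
    (F : {set {set 'I_n}}) : {set {set {set 'I_n}}} :=
  [set G : {set {set 'I_n}} | (G \subset F) && is_copy P G].

Definition num_copies (n : nat) (d : Order.disp_t) (P : finPOrderType d)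
    (F : {set {set 'I_n}}) : nat :=
  #|copies P F|.

Definition poset_free (n : nat) (d : Order.disp_t) (P : finPOrderType d)
    (F : {set {set 'I_n}}) : bool :=
  num_copies P F == 0.

(* When P is nonempty the empty family is P-free, so the maximum is not over *)
(* an empty range.                                                           *)
Definition La (n : nat) (d d' : Order.disp_t) (P : finPOrderType d)
    (Q : finPOrderType d') : nat :=
  \max_(F : {set {set 'I_n}} | poset_free P F) num_copies Q F.

Definition level (n k : nat) : {set {set 'I_n}} :=
  [set A : {set 'I_n} | #|A| == k].

Definition union_of_levels (n : nat) (F : {set {set 'I_n}}) : Prop :=
  exists L : {set 'I_n.+1}, F = \bigcup_(k in L) level n k.

(* The element a^i_h is Tagged _ h with tag i. The alias keeps this order    *)
(* apart from the library's lexicographic order on sigma types.              *)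
Definition multilevel (s : nat) (r : 'I_s -> nat) : Type := {i : 'I_s & 'I_(r i)}.

Section MultilevelOrder.
Variables (s : nat) (r : 'I_s -> nat).

HB.instance Definition _ := Finite.copy (multilevel r) {i : 'I_s & 'I_(r i)}.

Definition multilevel_lt (x y : multilevel r) : bool := tag x < tag y.

Definition multilevel_le (x y : multilevel r) : bool :=
  (x == y) || multilevel_lt x y.

Fact multilevel_lt_def x y :
  multilevel_lt x y = (y != x) && multilevel_le x y.
Proof.
rewrite /multilevel_le [y == x]eq_sym; case: eqP => //= ->.
by rewrite /multilevel_lt ltnn.
Qed.

Fact multilevel_le_refl : reflexive multilevel_le.
Proof. by move=> x; rewrite /multilevel_le eqxx. Qed.

Fact multilevel_le_anti : antisymmetric multilevel_le.
Proof.
move=> x y /andP[/orP[/eqP // | lt_xy] /orP[/eqP // | lt_yx]].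
by have := ltn_trans lt_xy lt_yx; rewrite ltnn.
Qed.

Fact multilevel_le_trans : transitive multilevel_le.
Proof.
move=> y x z /orP[/eqP -> // | lt_xy] /orP[/eqP <- | lt_yz].
  by rewrite /multilevel_le lt_xy orbT.
by rewrite /multilevel_le /multilevel_lt (ltn_trans lt_xy lt_yz) orbT.
Qed.

Fact multilevel_display : Order.disp_t. Proof. exact: Order.Disp tt tt. Qed.

HB.instance Definition _ := Order.isPOrder.Build multilevel_display
  (multilevel r) multilevel_lt_def multilevel_le_refl multilevel_le_anti
  multilevel_le_trans.

End MultilevelOrder.

Fact multilevel_leE (s : nat) (r : 'I_s -> nat) (x y : multilevel r) :
  (x <= y)%O = (x == y) || (tag x < tag y).
Proof. by []. Qed.

Fact multilevel_ltE (s : nat) (r : 'I_s -> nat) (x y : multilevel r) :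
  (x < y)%O = (tag x < tag y).
Proof. by []. Qed.

(* The chain P_k: the order is the natural one on ordinals. *)
Notation chain k := 'I_k (only parsing).

(* Main.v *)
(* In a P_{s+1}-free family F, the elements of G_i, over all copies G_1, ...,
   G_s of K_{r_1,...,r_s} in F, form an antichain F_i: a comparability
   between two of them would splice two copies into a chain of length s + 1.
   Call i a pivot if r_i = 1. Fixing the pivots of a copy, which form a chain
   of sets, leaves independent choices of r_j sets from the part of F_j in
   the gap between the neighbouring pivots, at most as many as for the
   largest level of that gap (Sperner). The resulting bound W(p) depends only
   on the orbit of the pivot tuple p under the permutations of [n], and
   |orbit of p| W(p) is at most the number of copies in suitable full levels.
   As each image of the flag of initial segments carries at most one pivot
   tuple of F, the LYM double count over permutations bounds the sum of W(p)
   by the maximum of the counts over unions of at most s full levels. *)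

Require Import Defs.
From HB Require Import structures.
From mathcomp Require Import all_boot all_order all_fingroup.

Set Implicit Arguments.
Unset Strict Implicit.
Unset Printing Implicit Defensive.

(** * An LYM inequality for orbits of a group action *)

(* A translate of the transversal set C contains at most one element of X, so
   counting the translates through each x gives an LYM inequality for orbits. *)
Lemma orbit_lym (aT : finGroupType) (rT : finType) (to : {action aT &-> rT})
    (Gr : {group aT}) (X C : {set rT}) (W : rT -> nat) (M : nat) :
    (forall x, x \in X -> exists2 g, g \in Gr & to x g \in C) ->
    (forall g, g \in Gr ->
      {in X &, forall x y, to x g \in C -> to y g \in C -> x = y}) ->
    (forall x, x \in X -> #|orbit to Gr x| * W x <= M) ->
  \sum_(x in X) W x <= M.
Proof.
move=> meetC C_transv leM; rewrite -(leq_pmul2l (cardG_gt0 Gr)) big_distrr /=.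
pose S x := [set g in Gr | to x g \in C].
apply: (@leq_trans (\sum_(x in X) M * #|S x|)).
  (* By orbit-stabiliser, |Gr| is |orbit of x| times |stabiliser of x|, and a right coset of the
     stabiliser fits inside [S x]. *)
  apply: leq_sum => x Xx; rewrite -(card_orbit_stab to Gr x) mulnAC.
  apply: leq_mul; first exact: leM.
  have [g Gg Cxg] := meetC x Xx; rewrite -(card_rcoset _ g).
  apply/subset_leq_card/subsetP => _ /rcosetP[h /setIP[Gh /astab1P xh] ->].
  by rewrite inE groupM // actM xh.
rewrite -big_distrr /= mulnC leq_mul2r; apply/orP; right.
rewrite -sum1_card.
under eq_bigr do rewrite -sum1_card.
(* After the exchange each [g] is counted for at most one [x], since [C] is a transversal. *)
rewrite (exchange_big_dep (mem Gr)) /=; last by move=> x g _ /setIdP[].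
apply: leq_sum => g Gg; rewrite sum1_card.
apply/card_le1P => x /andP[Xx /setIdP[_ Cx]] y.
rewrite inE; apply/andP/eqP => [[Xy /setIdP[_ Cy]] | ->].
  exact: (C_transv g).
by split; rewrite // inE Gg.
Qed.

(** * Initial segments and straightening of chains *)

Definition comparable (n : nat) (A B : {set 'I_n}) : bool :=
  (A \subset B) || (B \subset A).

(** In the linear order of ['I_n] these are the initial segments, that is, the members of one fixed
    full flag. *)
Definition downset (n : nat) (A : {set 'I_n}) : bool :=
  [forall x : 'I_n, forall y : 'I_n, (x \in A) && (y < x) ==> (y \in A)].

Lemma downsetP n (A : {set 'I_n}) :
  reflect (forall x y : 'I_n, x \in A -> y < x -> y \in A) (downset A).
Proof.
apply: (iffP 'forall_forallP) => dA x y => [Ax lt_yx | ].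
  by apply: (implyP (dA x y)); rewrite Ax.
by apply/implyP => /andP[]; apply: dA.
Qed.

Lemma downset_comparable n (A B : {set 'I_n}) :
  downset A -> downset B -> comparable A B.
Proof.
move=> /downsetP dA /downsetP dB; rewrite /comparable.
case: (boolP (A \subset B)) => //=.
case/subsetPn => x Ax Bx; apply/subsetP => y By.
have [lt_yx | lt_xy | /val_inj -> //] := ltngtP y x; first exact: dA lt_yx.
by rewrite (dB y x) in Bx.
Qed.

Lemma comparable_card n (A B : {set 'I_n}) :
  comparable A B -> #|A| = #|B| -> A = B.
Proof.
by case/orP => sAB eqAB; last (apply/esym); apply/eqP;
   rewrite eqEcard sAB eqAB leqnn.
Qed.

(* Sorting the points by the number of sets of the chain that miss them. *)
Lemma chain_straighten n (H : {set {set 'I_n}}) :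
    {in H &, forall A B, comparable A B} ->
  exists g : {perm 'I_n}, forall A, A \in H -> downset (g @: A).
Proof.
move=> chH; pose v x := #|[set A in H | x \notin A]|.
pose le x y := v x <= v y.
have le_tr : transitive le by move=> y x z; apply: leq_trans.
pose e := sort le (enum 'I_n).
have e_all x : x \in e by rewrite mem_sort mem_enum.
have e_sz : size e = n by rewrite size_sort size_enum_ord.
have e_idx x : index x e < n by rewrite -[X in _ < X]e_sz index_mem.
have g_inj : injective (fun x => Ordinal (e_idx x)).
  by move=> x y /(congr1 val) /= /index_inj; apply.
exists (perm g_inj) => A HA; apply/downsetP => _ y /imsetP[x Ax ->].
have -> : y = perm g_inj ((perm g_inj)^-1%g y) by rewrite permKV.
set z := (_ y); rewrite !permE /= => lt_zx.
apply/imsetP; exists z; rewrite ?permE //; apply/idPn => nAz.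
have le_zx : le z x.
  apply: (sorted_ltn_index le_tr) lt_zx => //.
  by apply: sort_sorted => a b; apply: leq_total.
(* A set of the chain that misses [x] is contained in [A], so it misses [z] too; [A] itself misses
   [z] but not [x]. *)
suff : v x < v z by rewrite ltnNge -/(le z x) le_zx.
apply: proper_card; apply/properP; split; last first.
  by exists A; rewrite inE HA ?Ax.
apply/subsetP => B; rewrite !inE => /andP[HB nBx]; rewrite HB /=.
have [sAB | sBA] := orP (chH A B HA HB).
  by rewrite (subsetP sAB) in nBx.
by apply: contra nAz; apply: (subsetP sBA).
Qed.

Lemma perm_imset1 n (A : {set 'I_n}) : (1%g : {perm 'I_n}) @: A = A.
Proof. by rewrite -[RHS]imset_id; apply: eq_imset => x; rewrite perm1. Qed.

Lemma perm_imsetM n (g h : {perm 'I_n}) (A : {set 'I_n}) :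
  (g * h)%g @: A = h @: (g @: A).
Proof. by rewrite -imset_comp; apply: eq_imset => x; rewrite permM. Qed.

Lemma card_perm_imset n (g : {perm 'I_n}) (A : {set 'I_n}) : #|g @: A| = #|A|.
Proof. by rewrite card_imset //; apply: perm_inj. Qed.

Lemma perm_proper n (g : {perm 'I_n}) (A B : {set 'I_n}) :
  A \proper B -> g @: A \proper g @: B.
Proof.
by rewrite !properEcard !card_perm_imset => /andP[/imsetS->].
Qed.

Lemma perm_comparable n (g : {perm 'I_n}) (A B : {set 'I_n}) :
  comparable (g @: A) (g @: B) -> comparable A B.
Proof.
have inj := @perm_inj _ g.
suff sub (C D : {set 'I_n}) : g @: C \subset g @: D -> C \subset D.
  by case/orP => /sub s; rewrite /comparable s ?orbT.
move=> sCD; apply/subsetP => x Cx; rewrite -(mem_imset _ _ inj).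
by apply: (subsetP sCD); apply: imset_f.
Qed.

(** * Sperner's theorem relative to a chain *)

Definition antichain n (H : {set {set 'I_n}}) : Prop :=
  {in H &, forall A B, comparable A B -> A = B}.

Lemma setactPE n (g : {perm 'I_n}) (A : {set 'I_n}) :
  ('P^*)%act A g = g @: A.
Proof. by []. Qed.

(** The orbit count is run with the permutations that fix every member of [Ch]. They preserve [I]
    and sizes, so the orbit of a set of [H] stays in one level of [I]. *)
Lemma sperner_over_chain n (Ch I H : {set {set 'I_n}}) :
    {in Ch &, forall A B, comparable A B} ->
    {in Ch & I, forall A B, comparable A B} ->
    (forall g : {perm 'I_n}, (forall A, A \in Ch -> g @: A = A) ->
      forall B, B \in I -> g @: B \in I) ->
    H \subset I -> antichain H ->
  #|H| <= \max_(k < n.+1) #|I :&: level n k|.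
Proof.
move=> chCh chI invI sHI acH; have [g0 g0P] := chain_straighten chCh.
rewrite -sum1_card; apply: (@orbit_lym _ _ ('P^*)%act 'C(Ch | 'P^*)%G H
  [set B : {set 'I_n} | downset (g0 @: B)] (fun=> 1)).
- move=> B HB; have IB := subsetP sHI B HB.
  have chBCh : {in B |: Ch &, forall A A', comparable A A'}.
    move=> A A' /setU1P[-> | ChA] /setU1P[-> | ChA'].
    + by rewrite /comparable subxx.
    + by rewrite /comparable orbC; apply: chI.
    + exact: chI.
    + exact: chCh.
  have [t tP] := chain_straighten chBCh.
  (* Both [t] and [g0] send each set of [Ch] to the initial segment of its size, so this product
     fixes [Ch]; it moves [B] to a set that [g0] straightens. *)
  exists (t * g0^-1)%g.
    apply/astabP => A ChA; rewrite setactPE perm_imsetM.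
    suff -> : t @: A = g0 @: A by rewrite -perm_imsetM mulgV perm_imset1.
    apply: comparable_card; last by rewrite !card_perm_imset.
    by apply: downset_comparable; [apply: tP; rewrite !inE ChA orbT |
      apply: g0P].
  by rewrite inE setactPE -perm_imsetM mulgKV; apply: tP; rewrite setU11.
- move=> g _ A B HA HB; rewrite !inE !setactPE => dA dB.
  apply: acH => //; apply: (@perm_comparable _ g).
  apply: (@perm_comparable _ g0).
  exact: downset_comparable.
move=> B HB; rewrite muln1.
have leBn : #|B| < n.+1 by rewrite ltnS -[X in _ <= X]card_ord max_card.
apply: leq_trans (leq_bigmax (Ordinal leBn)) => /=.
apply/subset_leq_card/subsetP => _ /orbitP[g /astabP gP <-].
rewrite !inE setactPE card_perm_imset eqxx andbT.
by apply: invI (subsetP sHI _ HB) => A /gP; rewrite setactPE.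
Qed.

(** * Fibre counts and layered tuples of families *)

Lemma sum_fibers_le (I J : finType) (h : I -> J) (A : {set I}) (B : {set J}) :
  \sum_(j in B) #|[set i in A | h i == j]| <= #|A|.
Proof.
rewrite -[#|A|]sum1_card (partition_big h predT) //= [leqRHS](bigID (mem B)) /=.
apply: leq_trans (leq_addr _ _); apply: leq_sum => j _.
by rewrite sum1dep_card.
Qed.

Definition below n (G H : {set {set 'I_n}}) : bool :=
  [forall A in G, forall B in H, A \proper B].

Lemma belowP n (G H : {set {set 'I_n}}) :
  reflect {in G & H, forall A B : {set 'I_n}, A \proper B} (below G H).
Proof.
apply: (iffP 'forall_in_forall_inP) => lt_GH A B GA; first exact: lt_GH.
by move=> HB; apply: lt_GH.
Qed.

(** A copy cut into its [s] levels. Only consecutive levels are compared; [layered_below] recovers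
    the remaining pairs when all [r i] are positive. *)
Definition layered n s (r : 'I_s -> nat) (Fs : 'I_s -> {set {set 'I_n}}) :
    {set {ffun 'I_s -> {set {set 'I_n}}}} :=
  [set G : {ffun 'I_s -> {set {set 'I_n}}} |
    [forall i, (G i \subset Fs i) && (#|G i| == r i)] &&
    [forall i : 'I_s, forall j : 'I_s,
       (j == i.+1 :> nat) ==> below (G i) (G j)]].

Lemma layeredP n s (r : 'I_s -> nat) (Fs : 'I_s -> {set {set 'I_n}})
    (G : {ffun 'I_s -> {set {set 'I_n}}}) :
  reflect [/\ forall i, G i \subset Fs i, forall i, #|G i| = r i
            & forall i j : 'I_s, j = i.+1 :> nat -> below (G i) (G j)]
          (G \in layered r Fs).
Proof.
rewrite inE; apply: (iffP andP).
  case=> /forallP GF /'forall_'forall_implyP Glt.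
  split=> [i | i | i j /eqP]; last exact: Glt.
    by case/andP: (GF i).
  by case/andP: (GF i) => _ /eqP.
case=> GF Gr Glt; split; first by apply/forallP => i; rewrite GF Gr eqxx.
by apply/'forall_'forall_implyP => i j /eqP; apply: Glt.
Qed.

(** Consecutive relations compose through a member of the intermediate level, which is nonempty. *)
Lemma layered_below n s (r : 'I_s -> nat) (Fs : 'I_s -> {set {set 'I_n}})
    (G : {ffun 'I_s -> {set {set 'I_n}}}) :
    (forall i, 0 < r i) -> G \in layered r Fs ->
  forall i j : 'I_s, i < j -> below (G i) (G j).
Proof.
move=> r_gt0 /layeredP[_ Gr Glt] i j lt_ij.
have [m def_j] : exists m, j = (i + m).+1 :> nat.
  by exists (j - i.+1); rewrite -addSn subnKC.
elim: m j def_j {lt_ij} => [|m IHm] j def_j.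
  by rewrite Glt // def_j addn0.
have lt_js : (i + m).+1 < s by rewrite -addnS ltnW // -def_j.
pose k := Ordinal lt_js.
have /card_gt0P[B GkB] : 0 < #|G k| by rewrite Gr.
have /belowP lt_ik := IHm k erefl.
have /belowP lt_kj : below (G k) (G j) by apply: Glt; rewrite def_j addnS.
apply/belowP => A C GA GC.
exact: proper_trans (lt_ik A B GA GkB) (lt_kj B C GkB GC).
Qed.

(** * Pivot tuples, gaps and independent choices *)

(** Blanking the other coordinates to [set0] makes every [below] condition on them vacuous. *)
Definition pivots n s (r : 'I_s -> nat) (G : {ffun 'I_s -> {set {set 'I_n}}}) :
    {ffun 'I_s -> {set {set 'I_n}}} :=
  [ffun i => if r i == 1 then G i else set0].

(** The sets strictly between the pivots at positions [i - 1] and [i + 1], where these exist. *)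
Definition gap n s (p : {ffun 'I_s -> {set {set 'I_n}}}) (i : 'I_s) :
    {set {set 'I_n}} :=
  [set B : {set 'I_n} | [forall j : 'I_s,
     ((j == i.+1 :> nat) ==> below [set B] (p j)) &&
     ((i == j.+1 :> nat) ==> below (p j) [set B])]].

Lemma gapP n s (p : {ffun 'I_s -> {set {set 'I_n}}}) (i : 'I_s)
    (B : {set 'I_n}) :
  reflect (forall j : 'I_s, forall A, A \in p j ->
             (j = i.+1 :> nat -> B \proper A) /\
             (i = j.+1 :> nat -> A \proper B))
          (B \in gap p i).
Proof.
rewrite inE; apply: (iffP forallP) => gapB j.
  move=> A pA; have /andP[/implyP gt_j /implyP lt_j] := gapB j.
  split=> /eqP adj; first by apply: (belowP _ _ (gt_j adj)); rewrite ?set11.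
  by apply: (belowP _ _ (lt_j adj)); rewrite ?set11.
apply/andP; split; apply/implyP => /eqP adj; apply/belowP.
  by move=> _ A /set1P-> pA; have [/(_ adj)] := gapB j A pA.
by move=> A _ pA /set1P->; have [_ /(_ adj)] := gapB j A pA.
Qed.

(* The tuples of layered r Fs with pivot tuple p lie in the product family
   (choices r Fs p), with equality when the F_i are full levels of the right
   sizes. *)
Definition choices n s (r : 'I_s -> nat) (Fs : 'I_s -> {set {set 'I_n}})
    (p : {ffun 'I_s -> {set {set 'I_n}}}) (i : 'I_s) : {set {set {set 'I_n}}} :=
  if r i == 1 then [set p i]
  else [set H : {set {set 'I_n}} | H \subset Fs i :&: gap p i & #|H| == r i].

Lemma card_choices n s (r : 'I_s -> nat) (Fs : 'I_s -> {set {set 'I_n}})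
    (p : {ffun 'I_s -> {set {set 'I_n}}}) :
  #|family (choices r Fs p)| =
  \prod_i (if r i == 1 then 1 else 'C(#|Fs i :&: gap p i|, r i)).
Proof.
rewrite card_family foldrE big_map big_enum; apply: eq_bigr => i _.
rewrite /choices; case: (r i == 1); first exact: cards1.
exact: cards_draws.
Qed.

Lemma layered_choices n s (r : 'I_s -> nat) (Fs : 'I_s -> {set {set 'I_n}})
    (G : {ffun 'I_s -> {set {set 'I_n}}}) :
  G \in layered r Fs -> G \in family (choices r Fs (pivots r G)).
Proof.
case/layeredP => GF Gr Glt; apply/familyP => i; rewrite /choices.
case: eqP => [ri1 | _]; first by rewrite /= inE ffunE ri1.
rewrite inE Gr eqxx andbT subsetI GF /=; apply/subsetP => B GB.
apply/gapP => j A; rewrite ffunE; case: eqP => [_ GA | _]; last by rewrite inE.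
by split=> /Glt/belowP; apply.
Qed.

(** * Permutations acting on pivot tuples *)

Definition shift n s (p : {ffun 'I_s -> {set {set 'I_n}}}) (g : {perm 'I_n}) :
    {ffun 'I_s -> {set {set 'I_n}}} :=
  [ffun i => [set g @: (A : {set 'I_n}) | A in p i]].

Lemma shift1 n s : (@shift n s)^~ 1%g =1 id.
Proof.
move=> p; apply/ffunP => i; rewrite ffunE -[RHS]imset_id.
by apply: eq_imset => A; apply: perm_imset1.
Qed.

Lemma shiftM n s (p : {ffun 'I_s -> {set {set 'I_n}}}) :
  act_morph (@shift n s) p.
Proof.
move=> g h; apply/ffunP => i; rewrite !ffunE -imset_comp.
by apply: eq_imset => A; apply: perm_imsetM.
Qed.

Definition shift_action n s := TotalAction (@shift1 n s) (@shiftM n s).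

Lemma card_gap_shift n s (p : {ffun 'I_s -> {set {set 'I_n}}}) g i k :
  #|gap p i :&: level n k| <= #|gap (shift p g) i :&: level n k|.
Proof.
rewrite -(card_imset _ (imset_inj (@perm_inj _ g))).
apply/subset_leq_card/subsetP => _ /imsetP[B /setIP[/gapP gapB lvB] ->].
rewrite inE; apply/andP; split; last by rewrite !inE card_perm_imset in lvB *.
apply/gapP => j ?; rewrite ffunE => /imsetP[A pA ->].
by have [gtA ltA] := gapB j A pA; split=> adj; apply: perm_proper; auto.
Qed.

(** Converse of [layered_choices] for full levels, along a whole orbit. Of two consecutive positions
    one is a pivot, so their relation is a shifted pivot relation or a gap condition; levels are
    preserved because permutations preserve size. *)
Lemma choices_layered n s (r : 'I_s -> nat) (Fs : 'I_s -> {set {set 'I_n}})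
    (l : 'I_s -> nat) (G0 G : {ffun 'I_s -> {set {set 'I_n}}})
    (g : {perm 'I_n}) :
    (forall i j : 'I_s, j = i.+1 :> nat -> r i = 1 \/ r j = 1) ->
    G0 \in layered r Fs ->
    (forall i, r i = 1 -> G0 i \subset level n (l i)) ->
    G \in family (choices r (fun i => level n (l i)) (shift (pivots r G0) g)) ->
  (G \in layered r (fun i => level n (l i)))
    && (pivots r G == shift (pivots r G0) g).
Proof.
move=> r_adj /layeredP[_ G0r G0lt] G0l /familyP Gch.
have Gpiv i : r i = 1 -> G i = [set g @: (A : {set 'I_n}) | A in G0 i].
  move=> ri1; have := Gch i.
  by rewrite /choices ri1 eqxx inE ffunE /= ffunE ri1 => /eqP.
have Ggap i : r i <> 1 ->
    (G i \subset level n (l i) :&: gap (shift (pivots r G0) g) i)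
      && (#|G i| == r i).
  by move=> /eqP/negPf ri1; have := Gch i; rewrite /choices ri1 inE.
apply/andP; split; last first.
  apply/eqP/ffunP => i; rewrite !ffunE; case: eqP => [/Gpiv //|_].
  by rewrite imset0.
apply/layeredP; split=> [i | i | i j adj].
- have [ri1 | ri1] := eqVneq (r i) 1; last first.
    by case/andP: (Ggap i (elimN eqP ri1)); rewrite subsetI => /andP[].
  rewrite (Gpiv i ri1); apply/subsetP => B.
  case/imsetP => A /(subsetP (G0l i ri1)) lA ->.
  by rewrite !inE card_perm_imset in lA *.
- have [ri1 | ri1] := eqVneq (r i) 1; last first.
    by case/andP: (Ggap i (elimN eqP ri1)) => _ /eqP.
  by rewrite (Gpiv i ri1) card_imset ?G0r //; apply/imset_inj/perm_inj.
apply/belowP => A B GA GB.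
have [ri1 | ri1] := eqVneq (r i) 1; have [rj1 | rj1] := eqVneq (r j) 1.
- move: GA GB; rewrite !Gpiv // => /imsetP[A' GA' ->] /imsetP[B' GB' ->].
  by apply: perm_proper; apply: (belowP _ _ (G0lt i j adj)).
- have /andP[/subsetP/(_ B GB)] := Ggap j (elimN eqP rj1).
  case/setIP => _ /gapP/(_ i A) gapB _.
  by case: gapB => [|_]; [rewrite !ffunE ri1 /= -Gpiv | apply].
- have /andP[/subsetP/(_ A GA)] := Ggap i (elimN eqP ri1).
  case/setIP => _ /gapP/(_ j B) gapA _.
  by case: gapA => [|+ _]; [rewrite !ffunE rj1 /= -Gpiv | apply].
by case: (r_adj i j adj) => r1; rewrite r1 in ri1 rj1.
Qed.

(** * Bounding layered tuples over antichains *)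

Lemma pivots_comparable n s (r : 'I_s -> nat) (Fs : 'I_s -> {set {set 'I_n}})
    (G : {ffun 'I_s -> {set {set 'I_n}}}) (j k : 'I_s) (A B : {set 'I_n}) :
    (forall i, 0 < r i) -> G \in layered r Fs ->
    A \in pivots r G j -> B \in pivots r G k ->
  comparable A B.
Proof.
move=> r_gt0 GF; rewrite !ffunE.
case: (r j =P 1) => [rj1 GA|]; last by rewrite inE.
case: (r k =P 1) => [rk1 GB|]; last by rewrite inE.
rewrite /comparable; have [lt_jk | lt_kj | /val_inj eq_jk] := ltngtP j k.
- by rewrite proper_sub // (belowP _ _ (layered_below r_gt0 GF lt_jk)).
- by rewrite orbC proper_sub // (belowP _ _ (layered_below r_gt0 GF lt_kj)).
subst k; have /layeredP[_ /(_ j) Gj _] := GF.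
have /card_le1_eqP Gj1 : #|G j| <= 1 by rewrite Gj rj1.
by rewrite (Gj1 A B GA GB) subxx.
Qed.

(** The pivots next to [i] form a chain comparable with every set of the gap, and permutations
    fixing them preserve the gap, so [sperner_over_chain] applies. *)
Lemma gap_sperner n s (r : 'I_s -> nat) (Fs : 'I_s -> {set {set 'I_n}})
    (G : {ffun 'I_s -> {set {set 'I_n}}}) (i : 'I_s) (H : {set {set 'I_n}}) :
    (forall i, 0 < r i) -> G \in layered r Fs -> antichain H ->
  #|H :&: gap (pivots r G) i|
    <= \max_(k < n.+1) #|gap (pivots r G) i :&: level n k|.
Proof.
move=> r_gt0 GF acH; set p := pivots r G.
pose near (j : 'I_s) := (j == i.+1 :> nat) || (i == j.+1 :> nat).
pose Ch := [set A : {set 'I_n} | [exists j, near j && (A \in p j)]].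
have ChP A : reflect (exists2 j, near j & A \in p j) (A \in Ch).
  by rewrite inE; apply: exists_inP.
apply: (@sperner_over_chain _ Ch).
- by move=> A B /ChP[j _ pA] /ChP[k _ pB];
     apply: (pivots_comparable r_gt0 GF pA pB).
- move=> A B /ChP[j near_j pA] /gapP/(_ j A pA)[gtA ltA]; rewrite /comparable.
  by case/orP: near_j => /eqP adj; [rewrite orbC|]; rewrite proper_sub; auto.
- move=> g fixCh B /gapP gapB; apply/gapP => j A pA.
  have [gtA ltA] := gapB j A pA.
  have fixA : near j -> g @: A = A by move=> near_j; apply/fixCh/ChP; exists j.
  by split=> adj; rewrite -fixA ?/near ?adj ?eqxx ?orbT //;
     apply: perm_proper; auto.
- exact: subsetIr.
by move=> A B /setIP[HA _] /setIP[HB _]; apply: acH.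
Qed.

Lemma layered_antichains_le n s (r : 'I_s -> nat)
    (Fs : 'I_s -> {set {set 'I_n}}) (M : nat) :
    (forall i, 0 < r i) ->
    (forall i j : 'I_s, j = i.+1 :> nat -> r i = 1 \/ r j = 1) ->
    (forall i, antichain (Fs i)) ->
    (forall l : 'I_s -> 'I_n.+1, #|layered r (fun i => level n (l i))| <= M) ->
  #|layered r Fs| <= M.
Proof.
move=> r_gt0 r_adj acF leM.
pose top (p : {ffun 'I_s -> {set {set 'I_n}}}) i :=
  \max_(k < n.+1) #|gap p i :&: level n k|.
pose W p := \prod_i (if r i == 1 then 1 else 'C(top p i, r i)).
(* Layered tuples are grouped by pivot tuple; by Sperner in each gap a class has at most [W p]
   members. *)
apply: (@leq_trans (\sum_(p in pivots r @: layered r Fs) W p)).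
  rewrite -sum1_card (partition_big_imset (pivots r)) /=.
  apply: leq_sum => _ /imsetP[G0 FG0 ->]; rewrite sum1_card.
  apply: (@leq_trans #|family (choices r Fs (pivots r G0))|).
    apply/subset_leq_card/subsetP => G /andP[FG /eqP <-].
    exact: layered_choices.
  rewrite card_choices; apply: leq_prod => i _; case: (r i == 1) => //.
  by apply/leq_bin2l/(gap_sperner (r := r) i r_gt0 FG0).
(* The transversal consists of the tuples made of initial segments only. *)
apply: (@orbit_lym _ _ (shift_action n s) [set: {perm 'I_n}]%G _
  [set p : {ffun 'I_s -> {set {set 'I_n}}} |
     [forall i, forall A in p i, downset A]] W).
- move=> _ /imsetP[G FG ->].
  pose H := \bigcup_i pivots r G i.
  have chH : {in H &, forall A B, comparable A B}.
    by move=> A B /bigcupP[i _ GA] /bigcupP[j _ GB];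
       apply: (pivots_comparable r_gt0 FG GA GB).
  have [g gP] := chain_straighten chH.
  exists g; rewrite ?inE //; apply/forallP => i; apply/forall_inP => ?.
  rewrite ffunE => /imsetP[A GA ->]; apply: gP.
  by apply/bigcupP; exists i.
- move=> g _ _ _ /imsetP[G FG ->] /imsetP[G' FG' ->].
  rewrite !inE => /'forall_forall_inP dG /'forall_forall_inP dG'.
  (* Two pivots at the same position that [g] straightens are comparable members of the antichain
     [Fs i], hence equal. *)
  apply/ffunP => i; have {dG dG'} := (dG i, dG' i); rewrite !ffunE.
  case: (r i =P 1) => // ri1 [dG dG'].
  have /layeredP[/(_ i) GF /(_ i)/eqP Gr _] := FG.
  have /layeredP[/(_ i) GF' /(_ i)/eqP Gr' _] := FG'.
  move: Gr Gr' GF GF' dG dG'; rewrite ri1 => /cards1P[A ->] /cards1P[B ->].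
  rewrite !sub1set !imset_set1 => FA FB /(_ _ (set11 _)) dA /(_ _ (set11 _)) dB.
  congr [set _]; apply: (acF i) => //; apply: (@perm_comparable _ g).
  exact: downset_comparable.
move=> _ /imsetP[G0 FG0 ->]; set p := pivots r G0.
have max_k i : {k : 'I_n.+1 | top p i = #|gap p i :&: level n k|}.
  by apply: eq_bigmax; rewrite card_ord.
(* At a pivot the level is the size of its only set; elsewhere it is a largest level of the gap. *)
pose l i : 'I_n.+1 :=
  if r i == 1 then inord (\max_(A in G0 i) #|A|) else sval (max_k i).
(* Each tuple in the orbit of [p] is the pivot tuple of at least [W p] layered tuples over the
   levels [l], and these fibres are disjoint. *)
apply: leq_trans (leM l); rewrite -sum_nat_const.
pose orb := orbit (shift_action n s) [set: _]%G p.
apply: leq_trans (sum_fibers_le (pivots r) _ orb).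
apply: leq_sum => _ /orbitP[g _ <-] /=.
apply: (@leq_trans #|family (choices r (fun i => level n (l i)) (shift p g))|).
  rewrite card_choices; apply: leq_prod => i _; rewrite /l.
  case: (r i == 1) => //; apply: leq_bin2l; rewrite setIC.
  by case: (max_k i) => k /= ->; apply: card_gap_shift.
apply/subset_leq_card/subsetP => G chG; rewrite inE.
apply: (choices_layered r_adj FG0 _ chG) => i ri1.
have /layeredP[_ /(_ i)/eqP Gr _] := FG0.
move: Gr; rewrite /l ri1 => /cards1P[A ->]; rewrite sub1set inE big_set1.
by rewrite inordK // ltnS -[leqRHS]card_ord max_card.
Qed.

(** * Strata of a chain-free family *)

Lemma chain_copy n s (F : {set {set 'I_n}}) (f : 'I_s -> {set 'I_n}) :
    (forall k, f k \in F) -> (forall k m : 'I_s, k < m -> f k \proper f m) ->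
  ~~ poset_free (chain s) F.
Proof.
move=> Ff ltf; rewrite /poset_free /num_copies cards_eq0; apply/set0Pn.
exists (f @: setT); rewrite inE; apply/andP; split.
  by apply/subsetP => _ /imsetP[k _ ->].
apply/existsP; exists (finfun f); apply/and3P; split.
- apply/injectiveP => k m; rewrite !ffunE => eq_f.
  apply/val_inj; have [/ltf | /ltf | //] := ltngtP k m;
  by rewrite eq_f properxx.
- by apply/eqP/setP => A; apply/imsetP/imsetP => -[k _ ->];
    exists k; rewrite ?ffunE ?inE.
apply/forallP => k; apply/forallP => m; apply/implyP; rewrite leEord !ffunE.
by rewrite leq_eqVlt => /predU1P[/val_inj -> // | /ltf/proper_sub].
Qed.

Definition embedding n s (r : 'I_s -> nat) (F : {set {set 'I_n}})
    (phi : {ffun multilevel r -> {set 'I_n}}) : bool :=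
  [forall x, phi x \in F]
    && [forall x : multilevel r, forall y : multilevel r,
          (tag x < tag y) ==> (phi x \proper phi y)].

(** The family F_i: all sets that occupy level [i] in some placement of the poset in [F]. *)
Definition stratum n s (r : 'I_s -> nat) (F : {set {set 'I_n}}) (i : 'I_s) :
    {set {set 'I_n}} :=
  [set A : {set 'I_n} | [exists phi : {ffun multilevel r -> {set 'I_n}},
     embedding F phi && [exists x, (tag x == i) && (phi x == A)]]].

(** One element is picked from each level, with the given one at level [i]. Indexing by [nat] eases
    splicing; from [s] on, [insubd] returns the default [i]. *)
Lemma stratum_chain n s (r : 'I_s -> nat) (F : {set {set 'I_n}}) i A :
    (forall i, 0 < r i) -> A \in stratum r F i ->
  exists f : nat -> {set 'I_n},
    [/\ f i = A, forall k, k < s -> f k \in F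
      & forall k m, k < m < s -> f k \proper f m].
Proof.
move=> r_gt0; rewrite inE.
case/existsP => phi /andP[/andP[/forallP Fphi /'forall_'forall_implyP lt_phi]].
case/existsP => x /andP[/eqP tx /eqP phix].
pose y k : multilevel r :=
  if tag x == k then x else Tagged (fun k => 'I_(r k)) (Ordinal (r_gt0 k)).
have ty k : tag (y k) = k by rewrite /y; case: eqP.
exists (fun k => phi (y (insubd i k))); split=> [|k _|k m /andP[lt_km lt_ms]].
- by rewrite valKd /y tx eqxx.
- exact: Fphi.
by apply: lt_phi; rewrite !ty !val_insubd lt_ms (ltn_trans lt_km).
Qed.

Lemma stratum_antichain n s (r : 'I_s -> nat) (F : {set {set 'I_n}}) i :
  (forall i, 0 < r i) -> poset_free (chain s.+1) F -> antichain (stratum r F i).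
Proof.
move=> r_gt0 freeF A B SA SB /orP sAB.
wlog {sAB} sAB : A B SA SB / A \subset B.
  by case: sAB => [sAB | sBA] W; [apply: W | apply/esym/W].
apply/eqP; rewrite eqEproper sAB /=; apply/negP => ltAB.
have [f [fi Ff ltf]] := stratum_chain r_gt0 SA.
have [g [gi Fg ltg]] := stratum_chain r_gt0 SB.
have le_fA k : k <= i -> f k \subset A.
  rewrite leq_eqVlt -fi => /predU1P[-> // | lt_ki].
  by rewrite proper_sub ?ltf ?lt_ki /=.
have le_Bg k : i <= k < s -> B \subset g k.
  rewrite leq_eqVlt -gi => /andP[/predU1P[<- // | lt_ik] lt_ks].
  by rewrite proper_sub ?ltg ?lt_ik.
suff: ~~ poset_free (chain s.+1) F by rewrite freeF.
(* The splice is f_0, ..., f_i = [A], then [B] = g_i, ..., g_(s-1). Position [i] is used from both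
   chains, which gives s + 1 sets. *)
apply: (@chain_copy _ _ _ (fun k => if k <= i then f k else g k.-1)).
  move=> [k lt_k] /=; case: leqP => [le_ki | lt_ik].
    by apply: Ff; apply: leq_ltn_trans le_ki _.
  by apply: Fg; case: k lt_k lt_ik.
move=> [k lt_k] [m lt_m] /= lt_km.
have [le_mi | lt_im] := leqP m i.
  by rewrite (leq_trans (ltnW lt_km) le_mi) ltf // lt_km (leq_ltn_trans le_mi).
case: m lt_m lt_im lt_km => // m lt_m lt_im lt_km /=.
have [le_ki | lt_ik] := leqP k i; last first.
  case: k lt_ik lt_km {lt_k} => //= k _; rewrite ltnS => lt_km.
  by rewrite ltg // lt_km.
apply: sub_proper_trans (le_fA k le_ki) (proper_sub_trans ltAB _).
by rewrite le_Bg // -ltnS lt_im.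
Qed.

(** Every copy is the union of the levels of a layered tuple over the strata, so the union map
    reaches all copies. *)
Lemma num_copies_le n s (r : 'I_s -> nat) (F : {set {set 'I_n}}) :
  num_copies (multilevel r) F <= #|layered r (stratum r F)|.
Proof.
pose U (G : {ffun 'I_s -> {set {set 'I_n}}}) := \bigcup_i G i.
apply: leq_trans (leq_imset_card U _).
apply/subset_leq_card/subsetP => H; rewrite inE => /andP[sHF].
case/existsP => phi /and3P[/injectiveP phi_inj /eqP imH].
move/'forall_'forall_implyP => le_phi.
have lt_phi (x y : multilevel r) : tag x < tag y -> phi x \proper phi y.
  move=> lt_xy; rewrite properEneq le_phi ?multilevel_leE ?lt_xy ?orbT // andbT.
  by apply: contraTneq lt_xy => /phi_inj ->; rewrite ltnn.
pose G := [ffun i => [set phi x | x : multilevel r & tag x == i]].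
apply/imsetP; exists G; last first.
  rewrite -imH; apply/setP => A; apply/imsetP/bigcupP => [[x _ ->] | [i _]].
    by exists (tag x) => //; rewrite ffunE imset_f ?inE.
  by rewrite ffunE => /imsetP[x _ ->]; exists x.
apply/layeredP; split=> [i | i | i j adj].
- apply/subsetP => A; rewrite ffunE => /imsetP[x]; rewrite inE => tx ->.
  rewrite inE; apply/existsP; exists phi; apply/andP; split; last first.
    by apply/existsP; exists x; rewrite tx eqxx.
  apply/andP; split; last by apply/'forall_'forall_implyP.
  by apply/forallP => y; rewrite (subsetP sHF) // -imH imset_f.
- rewrite ffunE card_imset //.
  have Tinj : injective
      (fun h : 'I_(r i) => Tagged (fun k => 'I_(r k)) h : multilevel r).
    by move=> h h' /eqP; rewrite eq_Tagged /= => /eqP.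
  rewrite -[RHS]card_ord -(card_imset _ Tinj); apply: eq_card => x.
  rewrite inE; apply/eqP/imsetP => [<- | [h _ -> //]].
  by exists (tagged x) => //; case: x.
apply/belowP => A B; rewrite !ffunE.
move=> /imsetP[x /[!inE] /eqP tx ->] /imsetP[y /[!inE] /eqP ty ->].
by apply: lt_phi; rewrite tx ty adj.
Qed.

(** * Copies in unions of full levels *)

(** Values of [l] may repeat, so this is a union of at most [s] levels. *)
Definition levels n s (l : 'I_s -> 'I_n.+1) : {set {set 'I_n}} :=
  \bigcup_(k in l @: setT) level n k.

Lemma mem_levels n s (l : 'I_s -> 'I_n.+1) (A : {set 'I_n}) :
  reflect (exists i, #|A| = l i) (A \in levels l).
Proof.
apply: (iffP bigcupP) => [[_ /imsetP[i _ ->]] | [i cA]].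
  by rewrite inE => /eqP; exists i.
by exists (l i); rewrite ?imset_f ?inE ?cA.
Qed.

(** The s + 1 sets of a chain would have distinct sizes, but at most [s] sizes occur. *)
Lemma levels_chain_free n s (l : 'I_s -> 'I_n.+1) :
  poset_free (chain s.+1) (levels l).
Proof.
rewrite /poset_free /num_copies cards_eq0; apply/eqP/setP => H; rewrite !inE.
apply/negP => /andP[sH /existsP[f /and3P[/injectiveP f_inj /eqP imH]]].
move/'forall_'forall_implyP => le_f.
have lf k : exists i, #|f k| = l i.
  by apply/mem_levels/(subsetP sH); rewrite -imH imset_f.
have cf_inj : injective (fun k => #|f k|).
  move=> k m eq_c; apply: f_inj; apply: comparable_card eq_c.
  by rewrite /comparable; case/orP: (leq_total k m) => /(le_f _ _)->;
     rewrite ?orbT.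
pose c k : 'I_n.+1 := inord #|f k|.
have cE k : c k = #|f k| :> nat.
  by rewrite inordK // ltnS -[leqRHS]card_ord max_card.
have c_inj : injective c by move=> k m /(congr1 val) /=; rewrite !cE => /cf_inj.
suff : #|c @: setT| <= #|l @: setT|.
  rewrite card_imset // cardsT card_ord leqNgt ltnS.
  by rewrite (leq_trans (leq_imset_card _ _)) // cardsT card_ord.
apply/subset_leq_card/subsetP => _ /imsetP[k _ ->]; have [i cfi] := lf k.
by apply/imsetP; exists i => //; apply: val_inj; rewrite /= cE.
Qed.

(** Once a layered tuple exists, [l] is strictly increasing, so a tuple is recovered from its union
    by sorting sets by size: the union map is injective, and its values are copies. *)
Lemma layered_levels_le n s (r : 'I_s -> nat) (l : 'I_s -> 'I_n.+1) :
    (forall i, 0 < r i) ->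
  #|layered r (fun i => level n (l i))| <= num_copies (multilevel r) (levels l).
Proof.
move=> r_gt0; set L := layered _ _.
have lt_l G : G \in L -> forall i j : 'I_s, i < j -> l i < l j.
  move=> LG i j lt_ij; have /layeredP[Gl Gr _] := LG.
  have /card_gt0P[A GA] : 0 < #|G i| by rewrite Gr.
  have /card_gt0P[B GB] : 0 < #|G j| by rewrite Gr.
  have := proper_card (belowP _ _ (layered_below r_gt0 LG lt_ij) A B GA GB).
  have := subsetP (Gl i) A GA; have := subsetP (Gl j) B GB.
  by rewrite !inE => /eqP-> /eqP->.
pose U (G : {ffun 'I_s -> {set {set 'I_n}}}) := \bigcup_i G i.
have GE G i : G \in L -> G i = U G :&: level n (l i).
  move=> LG; have /layeredP[Gl _ _] := LG.
  apply/setP => A; apply/idP/setIP => [GA | [/bigcupP[j _ GA] lA]].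
    by split; [apply/bigcupP; exists i | apply: (subsetP (Gl i))].
  have lA' := subsetP (Gl j) A GA.
  suff -> : i = j by [].
  have eq_l : l i = l j :> nat by move: lA lA'; rewrite !inE => /eqP <- /eqP.
  by apply/val_inj; have [/(lt_l G LG) | /(lt_l G LG) | //] := ltngtP i j;
     rewrite eq_l ltnn.
have U_inj : {in L &, injective U}.
  by move=> G G' LG LG' eqU; apply/ffunP => i; rewrite !GE // eqU.
rewrite -(card_in_imset U_inj).
apply/subset_leq_card/subsetP => _ /imsetP[G LG ->].
have /layeredP[Gl Gr _] := LG.
rewrite inE; apply/andP; split.
  apply/subsetP => A /bigcupP[i _ /(subsetP (Gl i))]; rewrite inE => /eqP lA.
  by apply/mem_levels; exists i.
(* The default [set0] is never reached, since [G i] has exactly [r i] members. *)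
pose phi := [ffun x : multilevel r => nth set0 (enum (G (tag x))) (tagged x)].
have lt_sz (x : multilevel r) : tagged x < size (enum (G (tag x))).
  by rewrite -cardE Gr.
have Gphi x : phi x \in G (tag x) by rewrite ffunE -mem_enum mem_nth.
have lt_phi (x y : multilevel r) : tag x < tag y -> phi x \proper phi y.
  by move=> /(layered_below r_gt0 LG)/belowP; apply; apply: Gphi.
apply/existsP; exists phi; apply/and3P; split.
- apply/injectiveP => x y eq_xy.
  have [/lt_phi | /lt_phi | /val_inj] := ltngtP (tag x) (tag y);
    rewrite ?eq_xy ?properxx //.
  case: x y eq_xy => i h [j h'] /= eq_xy eq_ij; subst j.
  move: eq_xy; rewrite !ffunE /= => /eqP.
  rewrite nth_uniq ?enum_uniq -?cardE ?Gr //.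
  by move/eqP/val_inj->.
- apply/eqP/setP => A; apply/imsetP/bigcupP => [[x _ ->] | [i _ GA]].
    by exists (tag x); rewrite ?Gphi.
  have lt_i : index A (enum (G i)) < r i.
    by rewrite -Gr cardE index_mem mem_enum.
  exists (Tagged (fun k => 'I_(r k)) (Ordinal lt_i)) => //.
  by rewrite ffunE /= nth_index ?mem_enum.
apply/'forall_'forall_implyP => x y; rewrite multilevel_leE.
by case/orP => [/eqP -> // | /lt_phi/proper_sub].
Qed.

(** * The optimal choice of levels *)

Theorem corollary1p12 (s : nat) (r : 'I_s -> nat)
  (s_gt0 : 0 < s)
  (r_gt0 : forall i : 'I_s, 0 < r i)
  (r_adj : forall i j : 'I_s, j = i.+1 :> nat -> r i = 1 \/ r j = 1) :
  exists n0 : nat, forall n : nat, n0 <= n ->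
    exists F : {set {set 'I_n}},
      [/\ union_of_levels F,
          poset_free (chain s.+1) F
        & La n (chain s.+1) (multilevel r) = num_copies (multilevel r) F].
Proof.
(* The argument is uniform in [n], so the threshold is 0. *)
exists 0 => n _.
have ffun_gt0 : 0 < #|{: {ffun 'I_s -> 'I_n.+1}}|.
  by rewrite card_ffun !card_ord expn_gt0.
(* [l] maximises the number of copies among all choices of [s] levels. *)
have [l l_max] := eq_bigmax
  (fun l : {ffun 'I_s -> 'I_n.+1} => num_copies (multilevel r) (levels l))
  ffun_gt0.
exists (levels l); split; first by exists (l @: setT).
  exact: levels_chain_free.
apply/eqP; rewrite eqn_leq; apply/andP; split; last first.
  by apply: leq_bigmax_cond; apply: levels_chain_free.
apply/bigmax_leqP => F freeF; apply: leq_trans (num_copies_le r F) _.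
apply: layered_antichains_le => // [i | l'].
  exact: stratum_antichain.
apply: leq_trans (layered_levels_le l' r_gt0) _.
rewrite -l_max; apply: leq_trans (leq_bigmax (finfun l')).
by rewrite /levels (eq_imset _ (ffunE l')).
Qed.
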